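(* Let $n \geq 3$ be an integer and let $G$ be a finite simple graph (undirected, no loops, no multiple edges) with at least one and at most $n(n-1)/2$ edges. Then each edge of $G$ is contained, on average, in at most $n-2$ triangles, i.e. $\frac{1}{|E(G)|}\sum_{e \in E(G)} t(e) \leq n-2$, where $t(e)$ is the number of triangles of $G$ containing the edge $e$. Equality holds only for the complete graph $K_n$.
   Context: A triangle of $G$ is a set of three pairwise adjacent vertices; it contains the three edges joining them.
   Formalization: ''Equality holds only for the complete graph K_n'' is proved up to isolated vertices: equality implies that G with its isolated vertices deleted is isomorphic to K_n (K_n plus an isolated vertex also attains equality). *)

(* Defs.v *)
From HB Require Import structures.
From mathcomp Require Import all_boot all_order all_algebra.

Set Implicit Arguments.
Unset Strict Implicit.
Unset Printing Implicit Defensive.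

Import Order.TTheory GRing.Theory Num.Theory.

Record sgraph := SGraph {
  vertex :> finType;
  adj : rel vertex;
  adj_sym : symmetric adj;
  adj_irrefl : irreflexive adj
}.

Definition edges (G : sgraph) : {set {set G}} :=
  [set e | [exists x, exists y, adj x y && (e == [set x; y])]].

Definition triangles (G : sgraph) : {set {set G}} :=
  [set T : {set G} | (#|T| == 3)
     && [forall x in T, forall y in T, (x != y) ==> adj x y]].

(* A triangle contains exactly the edges that are subsets of it. *)
Definition edge_triangles (G : sgraph) (e : {set G}) : nat :=
  #|[set T in triangles G | e \subset T]|.

(* The value is 0 for an edgeless graph, by the convention 0^-1 = 0. *)
Definition avg_edge_triangles (G : sgraph) : rat :=
  ((\sum_(e in edges G) (edge_triangles e)%:R) / #|edges G|%:R)%R.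

Definition graph_iso (G H : sgraph) : Prop :=
  exists2 f : G -> H, bijective f & forall x y, adj (f x) (f y) = adj x y.

Section Complete.
Variable n : nat.

Let complete_rel : rel 'I_n := fun i j => i != j.

Fact complete_rel_sym : symmetric complete_rel.
Proof. by move=> i j; rewrite /complete_rel eq_sym. Qed.

Fact complete_rel_irrefl : irreflexive complete_rel.
Proof. by move=> i; rewrite /complete_rel eqxx. Qed.

Definition complete_graph : sgraph :=
  SGraph complete_rel_sym complete_rel_irrefl.

End Complete.

Section Induced.
Variables (G : sgraph) (S : {set G}).

Let induced_rel : rel {x : G | x \in S} := fun x y => adj (val x) (val y).

Fact induced_rel_sym : symmetric induced_rel.
Proof. by move=> x y; apply: adj_sym. Qed.

Fact induced_rel_irrefl : irreflexive induced_rel.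
Proof. by move=> x; apply: adj_irrefl. Qed.

Definition induced_subgraph : sgraph :=
  SGraph induced_rel_sym induced_rel_irrefl.

End Induced.

(* Isolated vertices affect neither the edges nor the triangles, so extremal
   graphs can only be determined after discarding them. *)
Definition delete_isolated (G : sgraph) : sgraph :=
  induced_subgraph [set x : G | [exists y, adj x y]].

(* Main.v *)
(** Write [d] for the degree of a vertex [x], [m] for the number of edges, and
    [t] for the number of ordered pairs [(y, z)] such that [x, y, z] is a
    triangle.  Clearly [t <= d * (d - 1)], and [t <= 2 * (m - d)] because the
    edge [yz] avoids [x].  The first bound (when [d < n]) or the second one
    (when [n <= d], as [2 * m <= n * (n - 1)]) gives [t <= d * (n - 2)], with
    equality only for [d = 0] or [d = n - 1].  Summing over [x] yields the
    inequality.  In the case of equality every non-isolated vertex has degree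
    [n - 1], so there are at most [n] of them by the handshake lemma, and hence
    they form a clique. *)

Require Import Defs.
From HB Require Import structures.
From mathcomp Require Import all_boot all_order all_algebra.
From mathcomp Require Import zify.

Set Implicit Arguments.
Unset Strict Implicit.
Unset Printing Implicit Defensive.

Import Order.TTheory GRing.Theory Num.Theory.

Section Counting.
Variable G : sgraph.
Implicit Types x y z : G.

Definition neighbors x : {set G} := [set y | adj x y].
Definition common_neighbors x y : {set G} := neighbors x :&: neighbors y.
(** This is [t] of the overview: since pairs are ordered, each triangle at [x] counts twice. *)
Definition vertex_triangles x : nat :=
  \sum_(y | adj x y) #|common_neighbors x y|.

Lemma adj_neq x y : adj x y -> x != y.
Proof. by apply: contraTneq => ->; rewrite adj_irrefl. Qed.

Lemma eq_set2 (T : finType) (a b c d : T) : c != d ->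
  ([set a; b] == [set c; d]) = ((a, b) == (c, d)) || ((a, b) == (d, c)).
Proof.
move=> cd; apply/eqP/orP => [E|]; last by case=> /eqP[-> ->] //; rewrite setUC.
have := set22 c d; have := set21 c d; rewrite -E !inE !xpair_eqE.
case/orP=> /eqP ca /orP[] /eqP db; move: cd; rewrite ca db ?eqxx //; auto.
Qed.

(** Double counting: the ordered pairs spanning an edge [[set a; b]] are exactly [(a, b)] and
    [(b, a)]. *)
Lemma sum_adj_edges (F : {set G} -> nat) :
  \sum_x \sum_(y | adj x y) F [set x; y] = 2 * \sum_(e in edges G) F e.
Proof.
rewrite pair_big_dep /=.
rewrite (partition_big (fun p => [set p.1; p.2]) (mem (edges G))) /=; last first.
  case=> x y /= xy; rewrite inE; apply/existsP; exists x.
  by apply/existsP; exists y; rewrite xy eqxx.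
rewrite big_distrr /=; apply: eq_bigr => e; rewrite inE.
case/existsP=> a /existsP[b /andP[ab /eqP->]].
rewrite (eq_bigl (mem [set (a, b); (b, a)])) => [|[x y]]; last first.
  rewrite /= !inE eq_set2 ?adj_neq //.
  by apply: andb_idl => /orP[] /eqP[-> ->]; rewrite // adj_sym.
rewrite big_setU1 ?big_set1 /= ?inE ?xpair_eqE ?(negPf (adj_neq ab)) //.
by rewrite [[set b; a]]setUC; lia.
Qed.

Lemma sum_card_neighbors : \sum_x #|neighbors x| = 2 * #|edges G|.
Proof.
rewrite -sum1_card -(sum_adj_edges (fun=> 1)); apply: eq_bigr => x _.
by rewrite -sum1_card; apply: eq_bigl => y; rewrite inE.
Qed.

(** Adding the third vertex, [z |-> z |: [set x; y]], maps the common neighbors bijectively onto the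
    triangles containing the edge. *)
Lemma edge_trianglesE x y : adj x y ->
  edge_triangles [set x; y] = #|common_neighbors x y|.
Proof.
move=> xy; have xNy := adj_neq xy.
have disj z : z \in common_neighbors x y -> z \notin [set x; y].
  rewrite !inE => /andP[xz yz].
  by rewrite negb_or !(eq_sym z) (adj_neq xz) (adj_neq yz).
rewrite /edge_triangles -[RHS](card_in_imset (f := fun z => z |: [set x; y])).
  apply: eq_card => T; rewrite !inE; apply/andP/imsetP.
    case=> /andP[/eqP T3 /forall_inP Tadj] sT.
    have /cards1P[z Tz] : #|T :\: [set x; y]| == 1.
      by rewrite cardsD (setIidPr sT) T3 cards2 xNy.
    have : z \in T :\: [set x; y] by rewrite Tz set11.
    rewrite inE in_set2 negb_or => /andP[/andP[zx zy] zT].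
    have adjT u : u \in [set x; y] -> z != u -> adj u z.
      move=> uxy zu; have /forall_inP/(_ _ zT)/implyP := Tadj u (subsetP sT _ uxy).
      by apply; rewrite eq_sym.
    exists z; first by rewrite !inE !adjT // ?set21 ?set22.
    by rewrite -Tz setUC -{1}(setID T [set x; y]) (setIidPr sT).
  case=> z zc ->; have := disj z zc; move: zc; rewrite !inE => /andP[xz yz] zN.
  split; last exact: subsetUr.
  rewrite cardsU1 !inE zN cards2 xNy /=.
  apply/forall_inP => u uT; apply/forall_inP => v vT; apply/implyP => uv.
  move: uT vT uv; rewrite !inE => /or3P[] /eqP-> /or3P[] /eqP->;
    by rewrite ?eqxx // adj_sym.
(* Injectivity: [w] is the only element of [w |: [set x; y]] outside the edge. *)
move=> z w /disj zN /disj wN E.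
have : z \in w |: [set x; y] by rewrite -E setU11.
by rewrite in_setU1 (negPf zN) orbF => /eqP.
Qed.

Lemma sum_vertex_triangles :
  \sum_x vertex_triangles x = 2 * \sum_(e in edges G) edge_triangles e.
Proof.
rewrite -sum_adj_edges; apply: eq_bigr => x _.
by apply: eq_bigr => y xy; rewrite edge_trianglesE.
Qed.

Lemma vertex_triangles_le_deg x :
  vertex_triangles x <= #|neighbors x| * #|neighbors x|.-1.
Proof.
rewrite -[X in X * _]sum1_card big_distrl /=.
rewrite (eq_bigl (adj x)) => [|y]; last by rewrite inE.
apply: leq_sum => y xy; rewrite mul1n (cardsD1 y (neighbors x)) inE xy /=.
apply/subset_leq_card/subsetP => z; rewrite !inE => /andP[-> yz].
by rewrite eq_sym (adj_neq yz).
Qed.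

(** In the degree sum [2 * m], keep only [x] and its neighbors [y]. Each such [y] is adjacent to
    [x], which is not a common neighbor, so its degree is at least one more than the number of
    common neighbors. *)
Lemma vertex_triangles_le_edges x :
  vertex_triangles x + 2 * #|neighbors x| <= 2 * #|edges G|.
Proof.
rewrite -sum_card_neighbors (bigD1 x) //= mul2n -addnn addnCA leq_add2l.
rewrite -[#|neighbors x|]sum1_card [X in _ + X](eq_bigl (adj x)) => [|y]; last first.
  by rewrite inE.
rewrite -big_split /= [leqRHS](bigID (adj x)) /=.
apply: leq_trans (leq_addr _ _).
rewrite [leqRHS](eq_bigl (adj x)) => [|y]; last first.
  by apply: andb_idl => xy; rewrite eq_sym adj_neq.
apply: leq_sum => y xy; rewrite (cardsD1 x (neighbors y)) inE adj_sym xy addnC leq_add2l.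
apply/subset_leq_card/subsetP => z; rewrite !inE => /andP[xz ->].
by rewrite eq_sym (adj_neq xz).
Qed.

Lemma vertex_triangles_le n x : 2 < n -> 2 * #|edges G| <= n * n.-1 ->
  vertex_triangles x <= #|neighbors x| * (n - 2).
Proof.
move=> n2 mn.
have := vertex_triangles_le_deg x; have := vertex_triangles_le_edges x.
(* If [d < n], then [d - 1 <= n - 2]. If [n <= d], then [t + 2 * d <= n * (n - 1) <= d * (n - 1)],
   so [t <= d * (n - 3)]. *)
case: (ltnP #|neighbors x| n) => dn; nia.
Qed.

Lemma vertex_triangles_eq n x : 2 < n -> 2 * #|edges G| <= n * n.-1 ->
  0 < #|neighbors x| -> vertex_triangles x = #|neighbors x| * (n - 2) ->
  #|neighbors x| = n.-1.
Proof.
move=> n2 mn d0 E.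
have := vertex_triangles_le_deg x; have := vertex_triangles_le_edges x.
(* For [d < n], cancelling [d] in [d * (n - 2) <= d * (d - 1)] leaves only [d = n - 1]; for [n <= d]
   the bound [d * (n - 3)] is too small. *)
rewrite {}E; case: (ltnP #|neighbors x| n) => dn; nia.
Qed.

Lemma regular_clique n (S := [set x : G | [exists y, adj x y]]) :
  1 < n -> 0 < #|edges G| -> 2 * #|edges G| <= n * n.-1 ->
  {in S, forall x, #|neighbors x| = n.-1} ->
  #|S| = n /\ {in S &, forall x y, adj x y = (x != y)}.
Proof.
move=> n1 m0 mn reg.
have Sn : #|S| <= n.
  rewrite -(@leq_pmul2r n.-1) ?ltn_predRL //; apply: leq_trans mn.
  rewrite -sum_card_neighbors -sum_nat_const [leqRHS](bigID (mem S)) /=.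
  by apply: leq_trans (leq_addr _ _); apply: leq_sum => x /reg->.
(* A closed neighborhood lies in [S] and has [n] elements, while [S] has at most [n]. *)
have nbS x : x \in S -> x |: neighbors x = S.
  move=> xS; apply/eqP; rewrite eqEcard; apply/andP; split.
    rewrite subUset sub1set xS; apply/subsetP => y; rewrite !inE => xy.
    by apply/existsP; exists x; rewrite adj_sym.
  by rewrite cardsU1 !inE adj_irrefl reg //= add1n prednK // (ltn_trans _ n1).
split; last first.
  move=> x y xS; rewrite -(nbS x xS) !inE => /predU1P[->|xy].
    by rewrite eqxx adj_irrefl.
  by rewrite xy adj_neq.
have /card_gt0P[e] := m0; rewrite inE => /existsP[x xS].
have {}xS : x \in S.
  by case/existsP: xS => y /andP[xy _]; rewrite inE; apply/existsP; exists y.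
by rewrite -(nbS x xS) cardsU1 !inE adj_irrefl reg //= add1n prednK // (ltn_trans _ n1).
Qed.

End Counting.

(** Adjacency is disequality on both sides, so any enumeration of [S] is an isomorphism. *)
Lemma clique_iso_complete n (G : sgraph) (S : {set G}) :
  #|S| = n -> {in S &, forall x y, adj x y = (x != y)} ->
  graph_iso (induced_subgraph S) (complete_graph n).
Proof.
move=> Sn clS.
have cT : #|{: {x : G | x \in S}}| = n by rewrite card_sig -Sn; apply: eq_card.
exists (fun x => cast_ord cT (enum_rank x)).
  exists (fun i => enum_val (cast_ord (esym cT) i)) => x.
    by rewrite cast_ordK enum_rankK.
  by rewrite enum_valK cast_ordKV.
move=> x y; rewrite /= (inj_eq (@cast_ord_inj _ _ cT)) (inj_eq enum_rank_inj).
by rewrite (clS _ _ (valP x) (valP y)) val_eqE.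
Qed.

Theorem theorem2 (n : nat) (G : sgraph) (hn : 3 <= n)
    (hE1 : 1 <= #|edges G|) (hE2 : #|edges G| <= n * (n - 1) %/ 2) :
  (avg_edge_triangles G <= n%:R - 2)%R /\
  (avg_edge_triangles G = n%:R - 2 ->
     graph_iso (delete_isolated G) (complete_graph n))%R.
Proof.
have mn : 2 * #|edges G| <= n * n.-1.
  by rewrite mulnC -subn1; apply: leq_trans (leq_divM _ 2); rewrite leq_mul2r.
(* [leqif] carries the equality case along: the sums agree only if the bound is attained at every
   vertex. *)
have := leqif_sum (fun x (_ : true) => leqif_eq (vertex_triangles_le x hn mn)).
rewrite sum_vertex_triangles -big_distrl sum_card_neighbors /= -mulnA => -[le eq].
have m0 : (0 < #|edges G|%:R :> rat)%R by rewrite ltr0n.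
rewrite /avg_edge_triangles -natr_sum -natrB 1?ltnW //; split.
  by rewrite ler_pdivrMr // -natrM ler_nat mulnC -(leq_pmul2l (ltn0Sn 1)).
move/(canRL (divfK (lt0r_neq0 m0)))/eqP; rewrite -natrM eqr_nat => /eqP E.
move: eq; rewrite E [_ * #|_|]mulnC eqxx => /esym/forallP eq.
have reg : {in [set x : G | [exists y, adj x y]],
    forall x, #|neighbors x| = n.-1}.
  move=> x; rewrite inE => /existsP[y xy].
  apply: vertex_triangles_eq hn mn _ (eqP (implyP (eq x) isT)).
  by apply/card_gt0P; exists y; rewrite inE.
have [Sn clS] := regular_clique (ltnW hn) hE1 mn reg.
exact: clique_iso_complete Sn clS.
Qed.
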